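(* Let $F$ be a finitely generated free group and let $K$ be a finite set. Then: 1. The subspace of periodic measures is dense in $M(F,K)$. 2. Suppose $\psi_1,\dots,\psi_m\in X(F,K)$ and $E\subset F$ is a finite set. If $\mu\in M(F,K)$ is supported on the set $Y:=\{\phi\in X(F,K) : \exists\, i \text{ such that } \phi|_E=\psi_i|_E\}$, then there exist periodic measures $\lambda_j\in M(F,K)$, $j=1,2,\dots$, also supported on $Y$, such that $\lambda_j\to\mu$ (weak* ).
   Context: For a discrete group $F$ and a finite set $K$, $X(F,K)$ denotes the space of all functions $\phi:F\to K$ with the topology of uniform convergence on finite subsets (i.e. the product topology with $K$ discrete); it is compact and metrizable. $F$ acts on $X(F,K)$ by $(f\phi)(g)=\phi(f^{-1}g)$ for $f,g\in F$. $M(F,K)$ is the space of Borel probability measures on $X(F,K)$ invariant under this action, with the weak* topology. A measure $\mu\in M(F,K)$ is called periodic if its support is finite. *)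

(* Defs.v *)
From HB Require Import structures.
From mathcomp Require Import all_boot all_order all_algebra.
From mathcomp Require Import all_classical all_reals all_analysis.

Set Implicit Arguments.
Unset Strict Implicit.
Unset Printing Implicit Defensive.

Import numFieldNormedType.Exports.

Local Open Scope classical_set_scope.
Local Open Scope ring_scope.

Definition finitely_generated (F : groupType) : Prop :=
  exists (n : nat) (s : 'I_n -> F), forall H : set F,
    H 1%g ->
    (forall x y, H x -> H y -> H (x * y)%g) ->
    (forall x, H x -> H x^-1%g) ->
    (forall i, H (s i)) ->
    H = setT.

Definition free_basis (F : groupType) (I : Type) (s : I -> F) : Prop :=
  forall (G : groupType) (t : I -> G),
    exists! h : F -> G, monoid_morphism h /\ forall i, h (s i) = t i.

Definition free_group (F : groupType) : Prop :=
  exists (I : Type) (s : I -> F), free_basis s.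

(* Measurable types are pointed in this library, whence nonempty alphabets;
   over the empty alphabet there is no configuration, hence no probability
   measure. *)
#[short(type="pointedFinType")]
HB.structure Definition PointedFinite := {K of Finite K & Pointed K}.

Definition config (F : groupType) (K : pointedFinType) : Type :=
  {ptws F -> discrete_topology K}.

HB.instance Definition _ (F : groupType) (K : pointedFinType) :=
  Topological.copy (config F K) {ptws F -> discrete_topology K}.
HB.instance Definition _ (F : groupType) (K : pointedFinType) :=
  isPointed.Build (config F K) (fun _ => point).

HB.instance Definition _ (F : groupType) (K : pointedFinType) :=
  Measurable.copy (config F K) (g_sigma_algebraType (@open (config F K))).

Definition shift (F : groupType) (K : pointedFinType) (f : F)
    (phi : config F K) : config F K :=
  fun g => phi (f^-1 * g)%g.

Definition shift_invariant (R : realType) (F : groupType) (K : pointedFinType)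
    (mu : probability (config F K) R) : Prop :=
  forall (f : F) (A : set (config F K)),
    measurable A -> mu (shift f @^-1` A) = mu A.

Record invariant_measure (R : realType) (F : groupType) (K : pointedFinType) :=
  InvariantMeasure {
    invariant_measure_val :> probability (config F K) R ;
    _ : shift_invariant invariant_measure_val }.

HB.instance Definition _ (R : realType) (F : groupType) (K : pointedFinType) :=
  gen_eqMixin (invariant_measure R F K).
HB.instance Definition _ (R : realType) (F : groupType) (K : pointedFinType) :=
  gen_choiceMixin (invariant_measure R F K).

Definition integrate (R : realType) (F : groupType) (K : pointedFinType)
    (mu : invariant_measure R F K) :
    {ptws continuousType (config F K) R -> R} :=
  fun f => \int[mu]_x f x.

(* The weak* topology: the coarsest one making [mu |-> \int[mu]_x f x]
   continuous for every continuous [f : config F K -> R]. *)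
HB.instance Definition _ (R : realType) (F : groupType) (K : pointedFinType) :=
  Topological.copy (invariant_measure R F K)
    (initial_topology (@integrate R F K)).

Definition measure_support (R : realType) (F : groupType) (K : pointedFinType)
    (mu : invariant_measure R F K) : set (config F K) :=
  [set phi | forall U, open U -> U phi -> (0 < mu U)%E].

Definition periodic_measure (R : realType) (F : groupType) (K : pointedFinType) :
    set (invariant_measure R F K) :=
  [set mu | finite_set (measure_support mu)].

Definition supported_on (R : realType) (F : groupType) (K : pointedFinType)
    (mu : invariant_measure R F K) (Y : set (config F K)) : Prop :=
  mu (~` Y) = 0%E.

Definition agreeing_on (F : groupType) (K : pointedFinType) (m : nat)
    (psi : 'I_m -> config F K) (E : set F) : set (config F K) :=
  [set phi | exists i, forall g, E g -> phi g = psi i g].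

(* Main.v *)
Require Import Defs.
From HB Require Import structures.
From mathcomp Require Import all_boot all_order all_algebra all_fingroup.
From mathcomp Require Import all_classical all_reals all_analysis.
From mathcomp Require Import ring lra.

(** Fix an invariant measure [mu], a finite part [E] of the free group [F] with
    basis [s], and a finite set [B] containing [E] which is connected in the
    Cayley graph: every element of [B] is the value of a word all of whose
    suffixes have their values in [B].  Let [T] be the set of patterns, that is,
    of maps from [B] to [K].  The measure [mu] gives a weight [p t] to each
    pattern [t], and to each generator [s j] a joint law [q j] of the patterns
    of [phi] and of its translate by [(s j)^-1].  By invariance both marginals
    of [q j] are equal to [p].

    The vectors [(p, q)] with this property are the nonnegative solutions of a
    linear system with rational coefficients, so the actual one is a limit of
    rational solutions which vanish wherever it does.  Clearing denominators
    in such an approximation gives a finite set [V] labelled by patterns, with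
    label frequencies close to [p]; equality of the marginals says that the
    source and target labels of the edges counted by [q j] both have the same
    multiplicities as the labels of [V], so that they can be realized by a
    permutation of [V] which only joins labels [t] and [u] with [q j t u != 0]
    ([permutation_model]).

    As [F] is free, these permutations extend to an action of [F] on [V].
    Reading labels along the orbit of [v] gives a configuration [phi v], and
    the uniform measure on the [phi v] is invariant and has finite support
    ([finite_orbit_measure]).  A pair of patterns with [q j t u != 0] comes from
    an actual configuration, so the two patterns agree where they overlap;
    walking along words from the identity then shows that [phi v] restricts on
    [E] to the label of [v] ([glue_patterns]).  Hence the new measure is close
    to [mu] on every set depending only on the coordinates in [E], and it
    vanishes on those which are null for [mu] ([periodic_approximation]): this
    preservation of null sets is what keeps the support inside the prescribed
    cylinders.

    Continuous functions on the compact space of configurations are uniform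
    limits of functions of finitely many coordinates, so letting [E] grow
    along an enumeration of the countable group [F] gives weak* convergence
    ([weak_cvg_determined]).  Density is the case of an empty set of
    constraints. *)

Set Implicit Arguments.
Unset Strict Implicit.
Unset Printing Implicit Defensive.
Import Order.TTheory GRing.Theory Num.Theory.
Import numFieldNormedType.Exports.

Local Open Scope classical_set_scope.
Local Open Scope ring_scope.

(** * Rational approximation of linear systems *)

Lemma rational_row_approx (R : realType) (m : nat) (z : 'rV[R]_m) (d : R) :
  0 < d -> exists w : 'rV[rat]_m, forall k, `|ratr (w 0 k) - z 0 k| < d.
Proof.
move=> d0.
have /choice[w wP] : forall k : 'I_m, exists q : rat, `|ratr q - z 0 k| < d.
  move=> k.
  have [q] : exists q : rat, ratr q \in `]z 0 k - d, z 0 k + d[.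
    by apply: rat_in_itvoo; rewrite ltrBlDr -addrA ltrDl addr_gt0.
  rewrite in_itv /= => /andP[lo hi]; exists q.
  by rewrite ltr_distl lo hi.
by exists (\row_k w k) => k; rewrite mxE.
Qed.

(** Gaussian elimination commutes with field extension, so a real kernel vector
    is a real combination of the rational basis [kermx A]; it is enough to
    approximate the coefficients of that combination. *)
Lemma rational_kernel_approx (R : realType) (m n : nat) (A : 'M[rat]_(m, n))
    (x : 'rV[R]_m) (e : R) :
  0 < e -> x *m map_mx ratr A = 0 ->
  exists y : 'rV[rat]_m, y *m A = 0 /\ forall k, `|ratr (y 0 k) - x 0 k| < e.
Proof.
move=> e0 xA; have /submxP[z xE] : (x <= map_mx ratr (kermx A))%MS.
  by rewrite map_kermx; apply/sub_kermxP.
set C := map_mx ratr (kermx A) in xE.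
pose M := \sum_k \sum_j `|C j k| + 1.
have M0 : 0 < M by apply: ltr_wpDl => //; apply: sumr_ge0 => k _; apply: sumr_ge0.
have [w wP] := rational_row_approx z (divr_gt0 e0 M0).
exists (w *m kermx A); split.
  by rewrite -mulmxA mulmx_ker mulmx0.
move=> k.
have -> : ratr ((w *m kermx A) 0 k) - x 0 k =
    \sum_j (ratr (w 0 j) - z 0 j) * C j k.
  rewrite xE !mxE rmorph_sum /= -sumrB; apply: eq_bigr => j _.
  by rewrite rmorphM /= mulrBl /C !mxE.
apply: le_lt_trans (ler_norm_sum _ _ _) _.
apply: (@le_lt_trans _ _ (e / M * \sum_j `|C j k|)).
  rewrite mulr_sumr; apply: ler_sum => j _; rewrite normrM.
  by rewrite ler_wpM2r // ltW.
rewrite -mulrA gtr_pMr // mulrC ltr_pdivrMr // mul1r /M.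
rewrite ltr_pwDr // [leRHS](bigD1 k) //= lerDl.
by apply: sumr_ge0 => i _; apply: sumr_ge0.
Qed.

Lemma common_denominator (m : nat) (y : 'rV[rat]_m) :
  (forall k, 0 <= y 0 k) ->
  exists (N : nat) (n : 'I_m -> nat), (0 < N)%N /\
    forall k, (n k)%:R = N%:R * y 0 k.
Proof.
move=> y0; pose N := (\prod_k `|denq (y 0%R k)|)%N.
exists N, (fun k => (`|numq (y 0%R k)| * \prod_(i | i != k) `|denq (y 0%R i)|)%N).
split; first by apply: prodn_gt0 => k; rewrite absz_gt0 denq_eq0.
move=> k; rewrite /N [in RHS](bigD1 k) //= !natrM.
rewrite [RHS]mulrAC; congr (_ * _).
have dE : (`|denq (y 0%R k)|%N%:R : rat) = (denq (y 0 k))%:~R.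
  by rewrite -[RHS]ger0_norm ?ler0z ?denq_ge0 // -intr_norm pmulrn abszE.
have nE : (`|numq (y 0%R k)|%N%:R : rat) = (numq (y 0 k))%:~R.
  by rewrite -[RHS]ger0_norm ?ler0z ?numq_ge0 // -intr_norm pmulrn abszE.
by rewrite nE dE mulrC numqE.
Qed.

(** The equations are between partial sums of the unknowns; this shape covers
    the marginal constraints used below.  To keep the zeros of [x], the
    equations [x k = 0] are added to the system; an approximation finer than
    the least positive entry of [x] is then nonnegative. *)
Lemma integer_weights (R : realType) (X C : finType) (a b : C -> pred X)
    (x : X -> R) (e : R) :
  0 < e -> (forall k, 0 <= x k) ->
  (forall c, \sum_(k | a c k) x k = \sum_(k | b c k) x k) ->
  exists (N : nat) (n : X -> nat), [/\ (0 < N)%N,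
    forall c, (\sum_(k | a c k) n k = \sum_(k | b c k) n k)%N,
    forall k, `|(n k)%:R / N%:R - x k| < e &
    forall k, x k = 0 -> n k = 0%N].
Proof.
move=> e0 x0 xab.
(* [S] encodes the given equations and [Z] the vanishing of the zero entries. *)
pose S := (\matrix_(k < #|X|, c < #|C|)
  ((a (enum_val c) (enum_val k))%:R - (b (enum_val c) (enum_val k))%:R : rat)).
pose Z := diag_mx (\row_(k < #|X|) ((x (enum_val k) == 0)%:R : rat)).
pose v := (\row_(k < #|X|) x (enum_val k)).
have sumE (Q : pzRingType) (P : pred X) (u : X -> Q) :
    \sum_(k < #|X|) u (enum_val k) * (P (enum_val k))%:R = \sum_(k | P k) u k :> Q.
  rewrite (reindex enum_rank) /=; last exact/onW_bij/enum_rank_bij.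
  rewrite [RHS]big_mkcond /=; apply: eq_bigr => k _.
  by rewrite enum_rankK; case: (P _); rewrite ?mulr1 ?mulr0.
have vS : v *m map_mx ratr (row_mx S Z) = 0.
  rewrite map_row_mx mul_mx_row -[RHS]row_mx0; congr row_mx.
    apply/rowP => c; rewrite !mxE; under eq_bigr => k _.
      rewrite !mxE rmorphB /= !ratr_nat mulrBr; over.
    by rewrite sumrB !sumE xab subrr.
  rewrite map_diag_mx; apply/rowP => k; rewrite mul_mx_diag !mxE /= ratr_nat.
  by case: eqP => [->|]; rewrite ?mul0r ?mulr0.
pose e' := \big[Num.min/e]_(k | x k != 0) x k.
have e'0 : 0 < e'.
  apply: lt_bigmin => // k xk; rewrite lt_def xk x0 //.
have [y [yS yx]] := rational_kernel_approx e'0 vS.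
move: yS; rewrite mul_mx_row -[X in _ = X]row_mx0 => /eq_row_mx[yS yZ].
have yz k : x (enum_val k) = 0 -> y 0 k = 0.
  move=> xk; move/rowP: yZ => /(_ k); rewrite mul_mx_diag !mxE xk eqxx mulr1.
  by [].
have y0 k : 0 <= y 0 k.
  case: (eqVneq (x (enum_val k)) 0) => [/yz ->//|xk].
  rewrite -(ler0q R); have := yx k; rewrite mxE ltr_distl => /andP[+ _].
  move=> /ltW; apply: le_trans; rewrite subr_ge0.
  exact: bigmin_le_cond.
have [N [n [N0 nE]]] := common_denominator y0.
exists N, (fun k => n (enum_rank k)); split => //.
- move=> c; apply/eqP; rewrite -(eqr_nat rat) !natr_sum.
  rewrite -!(sumE _ _ (fun k => (n (enum_rank k))%:R)) -subr_eq0 -sumrB.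
  apply/eqP; transitivity (N%:R * (y *m S) 0 (enum_rank c)); last first.
    by rewrite yS mxE mulr0.
  rewrite mxE mulr_sumr; apply: eq_bigr => k _.
  by rewrite enum_valK mxE enum_rankK nE -mulrBr mulrA.
- move=> k; have := yx (enum_rank k); rewrite mxE enum_rankK => h.
  apply: lt_le_trans (bigmin_le_id _ _ _ _); apply: le_lt_trans h.
  rewrite -[(n _)%:R](ratr_nat R) nE rmorphM /= ratr_nat mulrAC divff ?mul1r //.
  by rewrite pnatr_eq0 -lt0n.
- move=> k xk; apply/eqP; rewrite -(eqr_nat rat) nE yz ?mulr0 //.
  by rewrite enum_rankK.
Qed.

Lemma integer_couplings (R : realType) (T J : finType) (p : T -> R)
    (q : J -> T -> T -> R) (e : R) :
  0 < e -> (forall t, 0 <= p t) -> (forall j t u, 0 <= q j t u) ->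
  (forall j t, \sum_u q j t u = p t) -> (forall j u, \sum_t q j t u = p u) ->
  exists (N : nat) (P : T -> nat) (Q : J -> T -> T -> nat),
  [/\ (0 < N)%N,
    forall j t, (\sum_u Q j t u = P t)%N /\ (\sum_u Q j u t = P t)%N,
    forall t, `|(P t)%:R / N%:R - p t| < e,
    forall t, p t = 0 -> P t = 0%N &
    forall j t u, q j t u = 0 -> Q j t u = 0%N].
Proof.
move=> e0 p0 q0 qr qc.
pose X : finType := (T + J * (T * T))%type.
pose C : finType := (J * T * bool)%type.
pose x (k : X) := match k with inl t => p t | inr jtu => q jtu.1 jtu.2.1 jtu.2.2 end.
pose a (c : C) (k : X) := if k is inl t then t == c.1.2 else false.
pose b (c : C) (k : X) := if k is inr jtu then (jtu.1 == c.1.1) &&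
  ((if c.2 then jtu.2.1 else jtu.2.2) == c.1.2) else false.
have sumL (M : nmodType) (y : X -> M) c : \sum_(k | a c k) y k = y (inl c.1.2).
  by rewrite (big_pred1 (inl c.1.2)) // => -[].
have sumR (M : nmodType) (y : X -> M) c : \sum_(k | b c k) y k =
    \sum_u y (inr (c.1.1, if c.2 then (c.1.2, u) else (u, c.1.2))).
  pose h u : X := inr (c.1.1, if c.2 then (c.1.2, u) else (u, c.1.2)).
  pose h' (k : X) := if k is inr jtu then if c.2 then jtu.2.2 else jtu.2.1
    else c.1.2.
  rewrite (reindex_onto h h') => [|[t|[j [t u]]]] //=.
    by apply: eq_bigl => u; rewrite /h /h' /=; case: c.2; rewrite !eqxx.
  by rewrite /h /h' /=; case: c.2 => /andP[/eqP -> /eqP ->].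
have x0 k : 0 <= x k by case: k => [t|[j [t u]]] /=.
have xab c : \sum_(k | a c k) x k = \sum_(k | b c k) x k.
  by rewrite sumL sumR /=; case: c => [[j t] []] /=; rewrite ?qr ?qc.
have [N [n [N0 nab nx nz]]] := integer_weights e0 x0 xab.
exists N, (fun t => n (inl t)), (fun j t u => n (inr (j, (t, u)))); split => //.
- move=> j t; have := nab (j, t, true); have := nab (j, t, false).
  by rewrite !sumL !sumR.
- by move=> t; apply: (nz (inl t)).
- by move=> j t u; apply: (nz (inr (j, (t, u)))).
Qed.

(** * Permutations with prescribed transitions *)

(** List the pairs [(t, u)], each repeated [Q t u] times.  The first components
    are a rearrangement of the labels [l], and so are the second components;
    the permutation sends the source of each pair to its target. *)
Lemma permutation_of_matrix (T : finType) (N : nat) (l : N.-tuple T)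
    (Q : T -> T -> nat) :
  (forall t, \sum_u Q t u = count_mem t l)%N ->
  (forall t, \sum_u Q u t = count_mem t l)%N ->
  exists s : 'S_N, forall i, (0 < Q (tnth l i) (tnth l (s i)))%N.
Proof.
move=> Qr Qc.
pose es := flatten [seq nseq (Q x.1 x.2) x | x <- enum {: T * T}].
have es_count (a : pred (T * T)) : count a es = (\sum_(x | a x) Q x.1 x.2)%N.
  rewrite /es count_flatten -map_comp sumnE big_map big_enum /= [RHS]big_mkcond.
  by apply: eq_bigr => x _; rewrite count_nseq; case: (a x); rewrite ?mul1n.
have es1 : perm_eq (map fst es) l.
  apply/allP => t _ /=; rewrite count_map es_count /= -Qr; apply/eqP.
  rewrite (reindex_onto (pair t) snd) => [|[u v] /= /eqP -> //].
  by apply: eq_bigl => u; rewrite /= !eqxx.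
have es2 : perm_eq (map snd es) l.
  apply/allP => t _ /=; rewrite count_map es_count /= -Qc; apply/eqP.
  rewrite (reindex_onto (pair^~ t) fst) => [|[u v] /= /eqP -> //].
  by apply: eq_bigl => u; rewrite /= !eqxx.
have /tuple_permP[r1 E1] := es1; have /tuple_permP[r2 E2] := es2.
have szes : size es = N by rewrite -(size_map fst) E1 size_tuple.
have es_nth (i : 'I_N) : exists x, [/\ (0 < Q x.1 x.2)%N,
    x.1 = tnth l (r1 i) & x.2 = tnth l (r2 i)].
  have i_es : (i < size es)%N by rewrite szes.
  have x0 : T * T by move: i_es; case: (es).
  exists (nth x0 es i); split.
  - have /flattenP[s /mapP[x _ ->]] := mem_nth x0 i_es.
    by rewrite mem_nseq => /andP[Q0 /eqP ->].
  - rewrite -(nth_map x0 x0.1) // E1 -[LHS]tnth_nth.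
    by rewrite tnth_mktuple.
  - rewrite -(nth_map x0 x0.2) // E2 -[LHS]tnth_nth.
    by rewrite tnth_mktuple.
exists (r1^-1 * r2)%g => i.
have [x [Q0 x1 x2]] := es_nth ((r1^-1)%g i).
by rewrite permM -x2 -[in tnth l i](permKV r1 i) -x1.
Qed.

(** The weights of [integer_couplings] only approximate [p] up to a common
    denominator [n], while frequencies are relative to their sum [M].  As [p]
    has total mass 1, the ratio [M / n] is within [#|T|] individual errors of
    1, which is why the precision [d] is divided by [#|T| + 1]. *)
Lemma permutation_model (R : realType) (T J : finType) (p : T -> R)
    (q : J -> T -> T -> R) (e : R) :
  0 < e -> (forall t, 0 <= p t) -> (forall j t u, 0 <= q j t u) ->
  \sum_t p t = 1 ->
  (forall j t, \sum_u q j t u = p t) -> (forall j u, \sum_t q j t u = p u) ->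
  exists (N : nat) (l : 'I_N.+1 -> T) (s : J -> 'S_N.+1),
  [/\ forall t, `|(\sum_(i < N.+1) (l i == t))%:R / N.+1%:R - p t| < e,
    forall i, p (l i) != 0 &
    forall j i, q j (l i) (l (s j i)) != 0].
Proof.
move=> e0 p0 q0 p1 qr qc.
pose c := Num.min (e / 2) 1; pose d := c / (#|T|%:R + 1).
have c0 : 0 < c by rewrite lt_min divr_gt0 ?ltr01.
have T0 : 0 < #|T|%:R + 1 :> R by rewrite ltr_wpDl.
have d0 : 0 < d by rewrite divr_gt0.
have [n [P [Q [n0 PQ Pp Pz Qz]]]] := integer_couplings d0 p0 q0 qr qc.
pose M := (\sum_t P t)%N.
have Mn : `|M%:R / n%:R - 1| < c.
  rewrite /M natr_sum mulr_suml -[X in _ - X]p1 -sumrB.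
  apply: le_lt_trans (ler_norm_sum _ _ _) _.
  apply: (@le_lt_trans _ _ (\sum_(t : T) d)).
    by apply: ler_sum => t _; apply: ltW.
  rewrite sumr_const -[_ *+ _]mulr_natr -mulrA gtr_pMr // mulrC.
  by rewrite ltr_pdivrMr // mul1r ltrDl.
have : (0 < M)%N.
  rewrite lt0n; apply/eqP => M0; move: Mn.
  by rewrite M0 mul0r sub0r normrN normr1 lt_min ltxx andbF.
case EM : M => [|N] // _.
pose r := flatten [seq nseq (P t) t | t <- enum T].
have r_count t : count_mem t r = P t.
  rewrite /r count_flatten -map_comp sumnE big_map big_enum /=.
  rewrite (bigD1 t) //= count_nseq /= eqxx mul1n big1 ?addn0 // => u ut.
  by rewrite count_nseq /= (negbTE ut).
have szr : size r == N.+1.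
  rewrite /r size_flatten /shape -map_comp sumnE big_map big_enum /= -EM.
  by apply/eqP; apply: eq_bigr => t _; rewrite size_nseq.
pose l := Tuple szr.
have /choice[s sP] : forall j, exists s : 'S_N.+1, forall i,
    (0 < Q j (tnth l i) (tnth l (s i)))%N.
  move=> j; apply: permutation_of_matrix => t; rewrite [RHS]r_count.
    exact: (PQ j t).1.
  exact: (PQ j t).2.
exists N, (tnth l), s; split.
- move=> t.
  have -> : (\sum_(i < N.+1) (tnth l i == t) = P t)%N.
    rewrite -r_count -sum1_count -[r]/(tval l) big_tuple [RHS]big_mkcond /=.
    by apply: eq_bigr => i _; case: eqP.
  (* Changing the denominator from [n] to [M] costs at most [|M / n - 1|]. *)
  have PM : (P t)%:R / N.+1%:R <= 1 :> R.
    rewrite ler_pdivrMr ?ltr0n // mul1r ler_nat -EM /M (bigD1 t) //=.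
    exact: leq_addr.
  have M0 : N.+1%:R != 0 :> R by rewrite pnatr_eq0.
  have n0R : n%:R != 0 :> R by rewrite pnatr_eq0 -lt0n.
  have -> : (P t)%:R / N.+1%:R - p t = (P t)%:R / N.+1%:R *
      - (M%:R / n%:R - 1) + ((P t)%:R / n%:R - p t).
    by rewrite EM; field; rewrite n0R addrC natr1.
  apply: le_lt_trans (ler_normD _ _) _; rewrite [ltRHS]splitr.
  have ce : c <= e / 2 by rewrite ge_min lexx.
  apply: ler_ltD.
    rewrite normrM normrN ger0_norm ?divr_ge0 //.
    apply: le_trans (ler_wpM2r _ PM) _ => //.
    by rewrite mul1r; apply: le_trans ce; apply: ltW.
  apply: lt_le_trans (Pp t) (le_trans _ ce).
  by rewrite ler_pdivrMr // ler_peMr ?(ltW c0) // lerDr.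
- move=> i; apply/eqP => /Pz.
  have : tnth l i \in r by rewrite mem_tnth.
  by rewrite -has_pred1 has_count r_count => /[swap] ->.
- by move=> j i; apply/eqP => /Qz; have := sP j i => /[swap] ->.
Qed.

(** * Words in the generators of a group *)

(** By freeness the inclusion of [s] in the subgroup [H] extends to a retraction
    [h] of [F] into [H]; composed with the inclusion it fixes [s], so by
    uniqueness it is the identity of [F]. *)
Lemma free_basis_generates (F : groupType) (I : Type) (s : I -> F) (H : set F) :
  free_basis s -> H 1%g ->
  (forall x y, H x -> H y -> H (x * y)%g) -> (forall x, H x -> H x^-1%g) ->
  (forall i, H (s i)) -> forall x, H x.
Proof.
move=> fs H1 HM HV Hs x.
pose P : pred F := fun x => x \in H.
have PG : group_closed P.
  split; first by rewrite unfold_in inE.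
  move=> y z; rewrite !unfold_in !inE => yH zH.
  by apply: HM => //; apply: HV.
pose G : groupType := HB.pack {y : F | P y} (SubChoice_isSubGroup.Build F P {y : F | P y} PG).
pose v : G -> F := fun y => sval (y : {y : F | P y}).
have vM : monoid.monoid_morphism v by split.
have PH i : P (s i) by rewrite /P inE.
have [h [[hM hs] _]] := fs G (fun i => exist _ (s i) (PH i) : G).
have [h1 [_ h1u]] := fs F s.
have hid : h1 = id by apply: h1u; split.
have <- : v (h x) = x.
  have -> : v (h x) = h1 x; last by rewrite hid.
  suff -> : h1 = v \o h by [].
  apply: h1u; split; last by move=> i /=; rewrite hs.
  by split=> [|y z] /=; rewrite ?hM.1 ?hM.2.
by have := svalP (h x : {y : F | P y}); rewrite /P inE.
Qed.

Definition letter (F : groupType) (I : Type) (s : I -> F) (a : I * bool) : F :=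
  if a.2 then s a.1 else (s a.1)^-1%g.

Definition eval_word (F : groupType) (I : Type) (s : I -> F) (w : seq (I * bool)) : F :=
  foldr (fun a x => (letter s a * x)%g) 1%g w.

Lemma eval_word_cat (F : groupType) (I : Type) (s : I -> F) (v w : seq (I * bool)) :
  eval_word s (v ++ w) = (eval_word s v * eval_word s w)%g.
Proof. by elim: v => [|a v IH] /=; rewrite ?mul1g // IH mulgA. Qed.

Lemma eval_word_inv (F : groupType) (I : Type) (s : I -> F) (w : seq (I * bool)) :
  exists v, eval_word s v = (eval_word s w)^-1%g.
Proof.
elim: w => [|a w [v IH]]; first by exists [::]; rewrite /= invg1.
exists (v ++ [:: (a.1, ~~ a.2)]); rewrite eval_word_cat IH /= mulg1 invgM.
by congr (_ * _)%g; rewrite /letter /=; case: a.2; rewrite //= invgK.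
Qed.

Lemma free_basis_words (F : groupType) (I : Type) (s : I -> F) :
  free_basis s -> forall g, exists w, eval_word s w = g.
Proof.
move=> fs; apply: (free_basis_generates fs).
- by exists [::].
- by move=> x y [v <-] [w <-]; exists (v ++ w); rewrite eval_word_cat.
- by move=> x [w <-]; apply: eval_word_inv.
- by move=> i; exists [:: (i, true)]; rewrite /= mulg1.
Qed.

Lemma finitely_generated_countable (F : groupType) :
  finitely_generated F -> exists e : nat -> F, forall g, exists n, e n = g.
Proof.
move=> [n [t tP]].
pose H : set F := [set g | exists w, eval_word t w = g].
have HT : H = setT.
  apply: tP.
  - by exists [::].
  - by move=> x y [v <-] [w <-]; exists (v ++ w); rewrite eval_word_cat.
  - by move=> x [w <-]; apply: eval_word_inv.
  - by move=> i; exists [:: (i, true)]; rewrite /= mulg1.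
have fw g : H g by rewrite HT.
exists (fun k => eval_word t (odflt [::] (unpickle k))) => g.
by have [w <-] := fw g; exists (pickle w); rewrite pickleK.
Qed.

(** * Sets of configurations depending on finitely many coordinates *)

Definition determined_by (F : groupType) (K : pointedFinType) (E : seq F)
    (Y : set (config F K)) : Prop :=
  forall phi psi : config F K, {in E, phi =1 psi} -> Y phi -> Y psi.

Lemma determined_byC (F : groupType) (K : pointedFinType) (E : seq F)
    (Y : set (config F K)) :
  determined_by E Y -> determined_by E (~` Y).
Proof.
by move=> EY phi psi e nY /EY Yphi; apply: nY; apply: Yphi => g /e.
Qed.

Lemma cylinder_nbhs (F : groupType) (K : pointedFinType) (E : seq F)
    (phi : config F K) : nbhs phi [set psi : config F K | {in E, phi =1 psi}].
Proof.
elim: E => [|g E IH]; first by apply: filterS filterT => psi _ g.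
have gphi : nbhs phi [set psi : config F K | phi g = psi g].
  have := @proj_continuous F (fun=> discrete_topology K) g phi [set phi g].
  move=> /(_ (discrete_set1 _)) h.
  have : nbhs phi ((fun psi : config F K => psi g) @^-1` [set phi g]) by exact: h.
  by apply: filterS => psi /= ->.
apply: filterS2 gphi IH => psi /= e1 e2 h.
by rewrite inE => /predU1P[->|/e2].
Qed.

Lemma determined_by_open (F : groupType) (K : pointedFinType) (E : seq F)
    (Y : set (config F K)) : determined_by E Y -> open Y.
Proof.
move=> EY; rewrite openE => phi Yphi.
by apply: filterS (cylinder_nbhs E phi) => psi /EY; apply.
Qed.

Lemma determined_by_measurable (F : groupType) (K : pointedFinType) (E : seq F)
    (Y : set (config F K)) : determined_by E Y -> measurable Y.
Proof. by move=> /determined_by_open oY; apply: sub_sigma_algebra. Qed.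

(** Sets containing a cylinder around [phi] form a filter whose projections all
    converge to the coordinates of [phi]; so this filter converges to [phi] in
    the product topology. *)
Lemma nbhs_cylinder (F : groupType) (K : pointedFinType) (phi : config F K)
    (U : set (config F K)) : nbhs phi U ->
  exists E : seq F, forall psi : config F K, {in E, phi =1 psi} -> U psi.
Proof.
pose G : set_system (config F K) := [set V |
  exists E : seq F, forall psi : config F K, {in E, phi =1 psi} -> V psi].
have GF : Filter G.
  split.
  - by exists [::].
  - move=> V W [E EV] [E' EW]; exists (E ++ E') => psi h; split.
      by apply: EV => g gE; apply: h; rewrite mem_cat gE.
    by apply: EW => g gE; apply: h; rewrite mem_cat gE orbT.
  - by move=> V W VW [E EV]; exists E => psi /EV /VW.
suff : G --> phi by apply.
apply/cvg_sup => g; apply/cvg_image.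
  by rewrite eqEsubset; split => // k _; exists (fun=> k).
move=> V /nbhs_singleton /= Vphi.
exists ((fun psi : config F K => psi g) @^-1` V).
  by exists [:: g] => psi h /=; rewrite -h ?mem_head.
by rewrite image_preimage // eqEsubset; split => // k _; exists (fun=> k).
Qed.

Lemma config_compact (F : groupType) (K : pointedFinType) :
  compact [set: config F K].
Proof.
have := @tychonoff F (fun=> discrete_topology K) (fun=> setT).
have -> : [set f : F -> discrete_topology K | forall i, [set: discrete_topology K] (f i)] = setT.
  by rewrite eqEsubset; split.
apply => _.
by apply: finite_compact; apply: (@finite_finset K).
Qed.

(** Uniform continuity: around each configuration some cylinder controls the
    oscillation of [f]; by compactness finitely many of them cover the space,
    and [E] collects the coordinates that they involve. *)
Lemma continuous_cylinder (R : realType) (F : groupType) (K : pointedFinType)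
    (f : config F K -> R) (e : R) : continuous f -> 0 < e ->
  exists E : seq F, forall phi psi : config F K,
    {in E, phi =1 psi} -> `|f phi - f psi| < e.
Proof.
move=> cf e0.
have /choice[D DP] : forall phi : config F K, exists E : seq F,
    forall psi : config F K, {in E, phi =1 psi} -> `|f phi - f psi| < e / 2.
  move=> phi; apply: nbhs_cylinder.
  have /cvgrPdist_lt h := cf phi.
  by apply: h; rewrite divr_gt0.
pose C (phi : config F K) := [set psi : config F K | {in D phi, phi =1 psi}].
have := @config_compact F K; rewrite compact_cover.
case/(_ (config F K) setT C).
- move=> phi _; apply: (@determined_by_open _ _ (D phi)) => psi psi' h hC g gD.
  by rewrite hC // h.
- by move=> phi _; exists phi.
move=> X _ XC.
exists (flatten [seq D phi | phi <- finmap.enum_fset X]) => phi psi h.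
have [x xX xphi] := XC phi I.
have xpsi : C x psi.
  move=> g gD; rewrite xphi //; apply: h; apply/flattenP.
  by exists (D x) => //; apply/mapP; exists x.
have -> : f phi - f psi = (f x - f psi) - (f x - f phi) by rewrite opprB [RHS]addrC subrKA.
apply: le_lt_trans (ler_normB _ _) _; rewrite [ltRHS]splitr.
by apply: ltrD; apply: DP.
Qed.

Lemma continuous_measurable (R : realType) (F : groupType) (K : pointedFinType)
    (f : config F K -> R) : continuous f -> measurable_fun setT f.
Proof.
move=> /continuousP cf; apply: (measurability _ (measurable_realfun.RGenOpens.measurableE R)).
move=> _ [_ [a [b ->] <-]]; rewrite setTI.
by apply: sub_sigma_algebra; apply: cf; apply: interval_open.
Qed.

Definition pattern (F : groupType) (K : pointedFinType) (E : seq F)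
    (phi : config F K) : {ffun seq_sub E -> K} := [ffun g => phi (val g)].

Lemma patternP (F : groupType) (K : pointedFinType) (E : seq F)
    (phi psi : config F K) :
  pattern E phi = pattern E psi <-> {in E, phi =1 psi}.
Proof.
split=> [/ffunP h g gE|h].
  by have := h (SeqSub gE); rewrite !ffunE.
by apply/ffunP => g; rewrite !ffunE; apply: h; apply: valP.
Qed.

Lemma pattern_determined (F : groupType) (K : pointedFinType) (E : seq F)
    (B : set {ffun seq_sub E -> K}) :
  determined_by E (pattern E @^-1` B).
Proof. by move=> phi psi /patternP /= ->. Qed.

(** * Probability measures and finite partitions *)

Lemma measure_fibers (R : realType) d (T : measurableType d)
    (mu : probability T R) (J : finType) (k : T -> J) (B : pred J) :
  (forall j, measurable (k @^-1` [set j])) ->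
  fine (mu (k @^-1` [set j | B j])) =
  \sum_(j | B j) fine (mu (k @^-1` [set j])).
Proof.
move=> mk.
have -> : k @^-1` [set j | B j] = \bigcup_(j in [set j | B j]) (k @^-1` [set j]).
  rewrite eqEsubset; split => [x Bx|x [j /= Bj kx]]; first by exists (k x).
  by rewrite /= kx.
rewrite measure_fin_bigcup //; last 2 first.
- exact: finite_finset.
- by move=> i j _ _ [x [/= <- <-]].
rewrite (fsbigE (enum B)) ?enum_uniq //; last 2 first.
- by move=> j /=; rewrite (mem_enum B j).
- by move=> j /= Bj; rewrite (mem_enum B j) => /negP; case.
rewrite big_enum_cond sum_fine; last by move=> i _; rewrite fin_num_measure.
congr fine; apply: eq_bigl => j; apply/andP/idP => [[]//|Bj].
by rewrite mem_set.
Qed.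

(** Compare [f] with the simple function [c \o k], whose integral is the sum. *)
Lemma integral_fibers (R : realType) d (T : measurableType d)
    (mu : probability T R) (J : finType) (k : T -> J) (f : T -> R) (c : J -> R)
    (e : R) :
  measurable_fun setT f -> (forall j, measurable (k @^-1` [set j])) ->
  (forall x, `|f x - c (k x)| <= e) ->
  `|\int[mu]_x f x - \sum_j c j * fine (mu (k @^-1` [set j]))| <= e.
Proof.
move=> mf mk fc.
pose g x := \sum_j c j * \1_(k @^-1` [set j]) x.
have gE x : g x = c (k x).
  rewrite /g (bigD1 (k x)) //= big1 ?addr0 ?indicE ?mem_set ?mulr1 // => j jk.
  rewrite indicE memNset ?mulr0 //= => kx; by rewrite kx eqxx in jk.
have ig1 j : mu.-integrable setT (EFin \o (\1_(k @^-1` [set j]) : T -> R)).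
  exact: integrable_indic.
have igj j : mu.-integrable setT (EFin \o (fun x => c j * \1_(k @^-1` [set j]) x)).
  by have := integrableZl measurableT (c j) (ig1 j); apply: eq_integrable.
have ig : mu.-integrable setT (EFin \o g).
  have := integrable_sum measurableT (index_enum J) (P := xpredT) (fun j _ => igj j).
  by apply: eq_integrable => // x _ /=; rewrite sumEFin.
have intg : \int[mu]_x g x = \sum_j c j * fine (mu (k @^-1` [set j])).
  rewrite /Rintegral; under eq_integral do rewrite /g -sumEFin.
  rewrite integral_sum // -sum_fine; last first.
    by move=> j _; apply: (integrable_fin_num _ (igj j)).
  apply: eq_bigr => j _.
  have := RintegralZl (c j) measurableT (ig1 j); rewrite /Rintegral => ->.
  by rewrite integral_indic // setIT.
have bf : [bounded f x | x in [set: T]].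
  exists (e + \sum_j `|c j|); split; first exact: num_real.
  move=> M eM x _; apply: le_trans (ltW eM).
  rewrite -[f x](subrK (c (k x))); apply: le_trans (ler_normD _ _) _.
  by apply: lerD; rewrite // (bigD1 (k x)) //= lerDl sumr_ge0.
have iff : mu.-integrable setT (EFin \o f).
  apply: measurable_bounded_integrable => //.
  by rewrite ltey_eq fin_num_measure.
rewrite -intg -RintegralB //.
have ifg : mu.-integrable setT (EFin \o (fun x => f x - g x)).
  by have := integrableB measurableT iff ig; apply: eq_integrable.
apply: le_trans (le_normr_Rintegral _ _) _ => //.
apply: (@le_trans _ _ (\int[mu]_(x in setT) e)).
  apply: le_Rintegral => //.
  - exact: integrable_norm.
  - exact: finite_measure_integrable_cst.
  - by move=> x _; rewrite gE.
have mu1 : fine (mu setT) = 1 by rewrite probability_setT.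
by rewrite Rintegral_cst // mu1 mulr1.
Qed.

(** * Uniform measures on finite orbits *)

Lemma uniform_probability (R : realType) d (T : measurableType d) (N : nat)
    (x : 'I_N.+1 -> T) :
  exists P : probability T R,
    forall A, P A = (\sum_(i < N.+1) (x i \in A)%:R / N.+1%:R)%:E.
Proof.
have N0 : 0 <= N.+1%:R^-1 :> R by rewrite invr_ge0.
pose m : {measure set T -> \bar R} := mscale (NngNum N0)
  (msum (fun i => \d_(x (inord i)) : {measure set T -> \bar R}) N.+1).
have mE A : m A = (\sum_(i < N.+1) (x i \in A)%:R / N.+1%:R)%:E.
  rewrite /m /mscale /= /msum -mulr_suml mulrC EFinM; congr (_ * _)%E.
  by rewrite -sumEFin; apply: eq_bigr => i _; rewrite /= /dirac /= indicE inord_val.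
have m1 : m setT = 1%E.
  rewrite mE; under eq_bigr do rewrite in_setT mul1r.
  by rewrite sumr_const card_ord -[_ *+ _]mulr_natr mulVf ?pnatr_eq0.
pose P : probability T R := HB.pack (Measure.sort m)
  (Measure_isProbability.Build d T R (Measure.sort m) m1).
by exists P.
Qed.

(** Invariance is a change of variable along the permutations [a f].  The support
    lies in the range of [phi]: any other [psi] differs from each [phi v] at
    some [g v], and the cylinder of [psi] over these points is null. *)
Lemma finite_orbit_measure (R : realType) (F : groupType) (K : pointedFinType)
    (N : nat) (phi : 'I_N.+1 -> config F K) (a : F -> 'S_N.+1) :
  (forall f v, Defs.shift f (phi v) = phi (a f v)) ->
  exists lambda : invariant_measure R F K, periodic_measure lambda /\
    forall A, lambda A = (\sum_(v < N.+1) (phi v \in A)%:R / N.+1%:R)%:E.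
Proof.
move=> ha; have [P PE] := uniform_probability R phi.
have PI : shift_invariant P.
  move=> f A mA; rewrite !PE; congr EFin.
  rewrite [RHS](reindex_inj (@perm_inj _ (a f))) /=.
  apply: eq_bigr => v _; congr ((nat_of_bool _)%:R / _); rewrite -ha.
  by apply/idP/idP; rewrite !inE.
exists (InvariantMeasure PI); split => //.
apply: (@sub_finite_set _ _ (range phi)); last exact: finite_image.
move=> psi hpsi; apply: contrapT => npsi.
have /choice[g gP] : forall v, exists g, phi v g <> psi g.
  move=> v; apply/not_existsP => h; apply: npsi; exists v => //.
  by apply/funext => g; apply: contrapT => /h.
pose E := [seq g v | v : 'I_N.+1].
have := hpsi [set psi' : config F K | {in E, psi =1 psi'}].
case/(_ _ _)/lt_eqF/eqP.
- apply: (@determined_by_open _ _ E) => psi1 psi2 e12 /= e1 h hE.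
  by rewrite e1 // e12.
- by [].
rewrite PE big1 // => v _; rewrite memNset ?mul0r //= => h.
by apply: (gP v); rewrite h //; apply/mapP; exists v; rewrite ?mem_enum.
Qed.

(** * Periodic approximation of an invariant measure *)

(** Being total, this can be evaluated at products of group elements without
    proofs that they lie in [B]; it is also a configuration with pattern [t]. *)
Definition lookup (F : groupType) (K : pointedFinType) (B : seq F)
    (t : {ffun seq_sub B -> K}) (g : F) : K :=
  if insub g is Some b then t b else point.

Lemma lookup_pattern (F : groupType) (K : pointedFinType) (B : seq F)
    (phi : config F K) : {in B, lookup (pattern B phi) =1 phi}.
Proof. by move=> g gB; rewrite /lookup insubT /= ffunE. Qed.

(** These elements form a path from [eval_word s w] to the identity in the
    Cayley graph. *)
Fixpoint suffix_values (F : groupType) (I : Type) (s : I -> F)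
    (w : seq (I * bool)) : seq F :=
  eval_word s w :: (if w is a :: w' then suffix_values s w' else [::]).

(** The relation between the pattern [t] of a configuration and the pattern [u]
    of its translate by [x^-1]: the window of the translate, moved back, meets
    [B] in the points [x * b]. *)
Definition compatible (F : groupType) (K : pointedFinType) (B : seq F) (x : F)
    (t u : {ffun seq_sub B -> K}) : Prop :=
  forall b, b \in B -> (x * b)%g \in B -> lookup t (x * b)%g = lookup u b.

Lemma compatible_pattern (F : groupType) (K : pointedFinType) (B : seq F)
    (x : F) (phi : config F K) :
  compatible x (pattern B phi) (pattern B (Defs.shift x^-1%g phi)).
Proof.
by move=> b bB xbB; rewrite !lookup_pattern // /Defs.shift invgK.
Qed.

(** Induction on the word, one generator at a time: when each suffix value lies
    in [B], compatibility transports the value read at [eval_word s w] in the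
    label of [v] to the value read at the identity in the label of its image.
    An inverse letter uses compatibility at the preimage of [v]. *)
Lemma glue_patterns (F : groupType) (K : pointedFinType) (I : eqType)
    (s : I -> F) (B : seq F) (N : nat) (l : 'I_N -> {ffun seq_sub B -> K})
    (h : F -> 'S_N) (w : seq (I * bool)) :
  monoid.monoid_morphism h ->
  (forall a, a \in w -> forall v, compatible (s a.1) (l v) (l (h (s a.1) v))) ->
  {subset suffix_values s w <= B} ->
  forall v, lookup (l (h (eval_word s w) v)) 1%g = lookup (l v) (eval_word s w).
Proof.
move=> [h1 hM]; elim: w => [|a w IH] wC wB v /=; first by rewrite h1 perm1.
have wB' : {subset suffix_values s w <= B}.
  by move=> g gw; apply: wB; rewrite /= inE gw orbT.
have xB : eval_word s w \in B by apply: wB'; case: (w) => [|? ?]; apply: mem_head.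
have axB : (letter s a * eval_word s w)%g \in B by apply: wB; apply: mem_head.
rewrite hM permM IH //; last by move=> a' a'w; apply: wC; rewrite inE a'w orbT.
have := wC a (mem_head a w); rewrite /letter in axB *; case: a.2 in axB * => C.
  by rewrite C.
have hK : h (s a.1) (h (s a.1)^-1%g v) = v.
  by rewrite -permM -hM mulVg h1 perm1.
have := C (h (s a.1)^-1%g v) ((s a.1)^-1 * eval_word s w)%g axB.
by rewrite hK mulKVg => ->.
Qed.

(** [B] adds to [E] the paths joining its points to the identity, and [J] only
    keeps the finitely many generators met on them, so that the linear system
    is finite; the other generators act trivially on the finite model. *)
Lemma periodic_approximation (R : realType) (F : groupType)
    (K : pointedFinType) (I : choiceType) (s : I -> F)
    (mu : invariant_measure R F K) (E : seq F) (e : R) :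
  free_basis s -> 0 < e ->
  exists lambda : invariant_measure R F K, [/\ periodic_measure lambda,
    forall Y, determined_by E Y -> `|fine (lambda Y) - fine (mu Y)| <= e &
    forall Y, determined_by E Y -> mu Y = 0%E -> lambda Y = 0%E].
Proof.
move=> fs e0.
have /choice[w wP] := free_basis_words fs.
pose B := 1%g :: flatten [seq suffix_values s (w g) | g <- E].
pose gens := [seq a.1 | a <- flatten [seq w g | g <- E]].
pose T : finType := {ffun seq_sub B -> K}.
pose J : finType := seq_sub gens.
pose pat : config F K -> T := pattern B.
pose pat2 (j : J) (phi : config F K) : T * T :=
  (pat phi, pat (Defs.shift (s (val j))^-1%g phi)).
pose p (t : T) : R := fine (mu (pat @^-1` [set t])).
pose q (j : J) (t u : T) : R := fine (mu (pat2 j @^-1` [set (t, u)])).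
have mpat t : measurable (pat @^-1` [set t]).
  exact: determined_by_measurable (@pattern_determined _ _ B [set t]).
have mpat2 j x : measurable (pat2 j @^-1` [set x]).
  apply: (@determined_by_measurable _ _ (B ++ [seq (s (val j) * b)%g | b <- B])).
  move=> phi psi epp /= <-; congr pair; apply/patternP => g gB.
    by rewrite epp // mem_cat gB.
  by rewrite /Defs.shift invgK epp // mem_cat map_f ?orbT.
have p0 t : 0 <= p t by rewrite fine_ge0.
have q0 j t u : 0 <= q j t u by rewrite fine_ge0.
have p1 : \sum_t p t = 1.
  have := measure_fibers mu xpredT mpat.
  rewrite (_ : _ @^-1` _ = setT) ?probability_setT; first by move=> <-.
  by rewrite eqEsubset; split.
have qr j t : \sum_u q j t u = p t.
  have := measure_fibers mu (fun x : T * T => x.1 == t) (mpat2 j).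
  rewrite (reindex_onto (pair t) snd) => [|[u v] /= /eqP -> //].
  move=> h; rewrite /q /p.
  rewrite (_ : pat @^-1` [set t] = pat2 j @^-1` [set x | x.1 == t]).
    by rewrite h; apply: eq_bigl => u; rewrite /= !eqxx.
  by rewrite eqEsubset; split => phi /= /eqP.
have qc j u : \sum_t q j t u = p u.
  have := measure_fibers mu (fun x : T * T => x.2 == u) (mpat2 j).
  rewrite (reindex_onto (pair^~ u) fst) => [|[v v'] /= /eqP -> //].
  move=> h; rewrite /q /p.
  have muI : shift_invariant mu by case: (mu).
  rewrite -(muI (s (val j))^-1%g) //.
  rewrite (_ : _ @^-1` _ = pat2 j @^-1` [set x | x.2 == u]).
    by rewrite h; apply: eq_bigl => t; rewrite /= !eqxx.
  by rewrite eqEsubset; split => phi /= /eqP.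
have [N [l [sg [lp pl ql]]]] : exists (N : nat) (l : 'I_N.+1 -> T)
    (sg : J -> 'S_N.+1),
  [/\ forall t, `|(\sum_(i < N.+1) (l i == t))%:R / N.+1%:R - p t| <
         e / (#|T|%:R + 1),
    forall i, p (l i) != 0 &
    forall j i, q j (l i) (l (sg j i)) != 0].
  apply: permutation_model => //.
  by rewrite divr_gt0 // ltr_wpDl.
have [h [[hM hs] _]] := fs 'S_N.+1 (fun i => oapp sg 1%g (insub i : option J)).
(* Patterns and transitions of nonzero weight occur in actual configurations. *)
have realized t : p t != 0 -> exists phi, pat phi = t.
  apply: contra_neqP => /forallNP npt; rewrite /p.
  by rewrite (_ : _ @^-1` _ = set0) ?measure0 // -subset0 => phi /npt.
have realized2 j t u : q j t u != 0 -> compatible (s (val j)) t u.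
  move=> qtu; have [phi []] : exists phi, pat2 j phi = (t, u).
    move: qtu; apply: contra_neqP => /forallNP npt; rewrite /q.
    by rewrite (_ : _ @^-1` _ = set0) ?measure0 // -subset0 => phi /npt.
  by move=> <- <-; apply: compatible_pattern.
pose phi (v : 'I_N.+1) : config F K := fun g => lookup (l (h g v)) 1%g.
have phiE v : {in E, phi v =1 lookup (l v)}.
  move=> g gE; rewrite /phi.
  have := @glue_patterns F K I s B _ l h (w g) hM; rewrite wP; apply => //.
  - move=> a aw v'; have aJ : a.1 \in gens.
      by apply: map_f; apply/flattenP; exists (w g) => //; apply: map_f.
    rewrite hs (insubT (fun x => x \in gens) aJ) /=.
    exact: (realized2 (SeqSub aJ)).
  - move=> b bw; rewrite inE; apply/orP; right; apply/flattenP.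
    by exists (suffix_values s (w g)) => //; apply: map_f.
have shift_phi f v : Defs.shift f (phi v) = phi (h f^-1%g v).
  by apply/funext => g; rewrite /phi /Defs.shift hM.2 permM.
have [lambda [lamP lamE]] := finite_orbit_measure R shift_phi.
have EB g : g \in E -> g \in B.
  move=> gE; rewrite inE; apply/orP; right; apply/flattenP.
  exists (suffix_values s (w g)); first exact: map_f.
  by rewrite -{1}(wP g); case: (w g) => [|? ?]; apply: mem_head.
pose in_pat (Y : set (config F K)) (t : T) : bool := `[< exists psi, pat psi = t /\ Y psi >].
have patE Y psi : determined_by E Y -> Y psi <-> in_pat Y (pat psi).
  move=> EY; split=> [Ypsi|/asboolP[psi' [/patternP pp Yp]]].
    by apply/asboolP; exists psi.
  by apply: (EY _ _ _ Yp) => g /EB; apply: pp.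
(* On [E], the configuration [phi v] agrees with any [psi] of pattern [l v]. *)
have phiY Y v : determined_by E Y -> Y (phi v) <-> in_pat Y (l v).
  move=> EY; have [psi psil] := realized _ (pl v).
  rewrite -psil -patE //.
  have e1 : {in E, phi v =1 psi}.
    by move=> g gE; rewrite phiE // -psil lookup_pattern // EB.
  by split; apply: EY => // g gE; rewrite e1.
have muY Y : determined_by E Y -> fine (mu Y) = \sum_(t | in_pat Y t) p t.
  move=> EY; rewrite -(measure_fibers mu (in_pat Y) mpat).
  by congr (fine (mu _)); rewrite eqEsubset; split => psi /(patE _ _ EY).
exists lambda; split => //.
- move=> Y EY; rewrite muY // lamE /=.
  have cnt (v : 'I_N.+1) : (phi v \in Y)%:R = \sum_(t | in_pat Y t) (l v == t)%:R :> R.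
    have -> : (phi v \in Y) = in_pat Y (l v).
      by apply/idP/idP; rewrite inE => /(phiY _ _ EY).
    rewrite big_mkcond (bigD1 (l v)) //= eqxx big1 ?addr0; first by case: ifP.
    by move=> t; rewrite eq_sym => /negPf ->; case: ifP.
  rewrite -mulr_suml (eq_bigr _ (fun v _ => cnt v)).
  rewrite exchange_big /= mulr_suml -sumrB.
  apply: le_trans (ler_norm_sum _ _ _) _.
  apply: (@le_trans _ _ (\sum_(t : T) e / (#|T|%:R + 1))).
    rewrite [leRHS](bigID (in_pat Y)) /= -[leLHS]addr0; apply: lerD.
      by apply: ler_sum => t _; rewrite -natr_sum; apply/ltW/lp.
    by apply: sumr_ge0 => t _; rewrite divr_ge0 ?addr_ge0 // ltW.
  rewrite sumr_const -[_ *+ _]mulr_natr -mulrA ger_pMr // mulrC.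
  by rewrite ler_pdivrMr ?mul1r ?lerDl // ltr_wpDl.
- move=> Y EY Y0; rewrite lamE big1 // => v _.
  rewrite memNset ?mul0r // => /phiY => /(_ EY) Yl.
  have := muY _ EY; rewrite Y0 => /esym/eqP.
  rewrite psumr_eq0 // => /allP /(_ (l v)).
  by rewrite mem_index_enum Yl (negPf (pl v)) => /(_ isT).
Qed.

(** * Weak* convergence *)

(** Unfolds the initial topology: it is pulled back from a product of copies of
    [R], where convergence is coordinatewise. *)
Lemma weak_cvg (R : realType) (F : groupType) (K : pointedFinType)
    (lambda : nat -> invariant_measure R F K) (mu : invariant_measure R F K) :
  (forall f : continuousType (config F K) R,
     integrate (lambda j) f @[j --> \oo] --> integrate mu f) ->
  lambda @ \oo --> mu.
Proof.
move=> h.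
have hp : (@integrate R F K \o lambda) @ \oo --> integrate mu.
  apply/cvg_sup => f; apply/cvg_image.
    by rewrite eqEsubset; split => // x _; exists (fun=> x).
  move=> V /(h f) hV.
  exists ((fun g : continuousType (config F K) R -> R => g f) @^-1` V) => //.
  by rewrite image_preimage // eqEsubset; split => // x _; exists (fun=> x).
move=> U /= [_ [[V oV <-] Vmu] VU].
have hV : \forall j \near \oo, V (integrate (lambda j)).
  exact: hp V (open_nbhs_nbhs (conj oV Vmu)).
have hU : \forall j \near \oo, U (lambda j).
  by apply: filterS hV => j; apply: VU.
exact: hU.
Qed.

(** A continuous function is within [e / 4] of a function [c] of the pattern over
    some finite [E], whose integral is a finite combination of measures of
    sets depending on [E]; the two errors of [e / 4] leave [e / 2] for these. *)
Lemma weak_cvg_determined (R : realType) (F : groupType) (K : pointedFinType)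
    (lambda : nat -> invariant_measure R F K) (mu : invariant_measure R F K) :
  (forall E Y, determined_by E Y -> fine (lambda j Y) @[j --> \oo] --> fine (mu Y)) ->
  lambda @ \oo --> mu.
Proof.
move=> h; apply: weak_cvg => f; apply/cvgrPdist_le => e e0.
have cf : continuous f by exact: cts_fun.
have e4 : 0 < e / 4 by rewrite divr_gt0.
have [E Ef] := continuous_cylinder cf e4.
pose pat : config F K -> {ffun seq_sub E -> K} := pattern E.
pose c (t : {ffun seq_sub E -> K}) : R := f (lookup t : config F K).
have fc phi : `|f phi - c (pat phi)| <= e / 4.
  by apply/ltW/Ef => g gE; rewrite lookup_pattern.
have mpat t : measurable (pat @^-1` [set t]).
  exact: determined_by_measurable (@pattern_determined _ _ E [set t]).
have approx (nu : invariant_measure R F K) :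
    `|integrate nu f - \sum_t c t * fine (nu (pat @^-1` [set t]))| <= e / 4.
  exact: (integral_fibers nu (continuous_measurable cf) mpat fc).
have : \sum_t c t * fine (lambda j (pat @^-1` [set t])) @[j --> \oo] -->
    \sum_t c t * fine (mu (pat @^-1` [set t])).
  apply: cvg_big => [|t _]; first exact: add_continuous.
  apply: cvgMl_tmp; apply: h.
  exact: (@pattern_determined _ _ E [set t]).
have e2 : 0 < e / 2 by rewrite divr_gt0.
move=> /cvgrPdist_le /(_ _ e2); apply: filterS => j.
have := approx mu; have := approx (lambda j).
rewrite !ler_norml => /andP[? ?] /andP[? ?] /andP[? ?].
by apply/andP; split; lra.
Qed.

(** The set of constraints depends only on [E], which is part of every window
    [Ej j]; its complement is null for [mu], hence for each [lambda j]. *)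
Lemma periodic_approximation_on_cylinders (R : realType) (F : groupType)
    (K : pointedFinType) (m : nat) (psi : 'I_m -> config F K) (E : set F)
    (mu : invariant_measure R F K) :
  finitely_generated F -> free_group F -> finite_set E ->
  supported_on mu (agreeing_on psi E) ->
  exists lambda : nat -> invariant_measure R F K,
    (forall j, periodic_measure (lambda j) /\
       supported_on (lambda j) (agreeing_on psi E)) /\
    lambda @ \oo --> mu.
Proof.
move=> fgF [I [s fs]] /finite_seqP[Es EE] muY.
have [enumF enumFP] := finitely_generated_countable fgF.
pose Ej j := Es ++ [seq enumF i | i <- iota 0 j].
have j0 j : 0 < j.+1%:R^-1 :> R by rewrite invr_gt0.
(* The generators met along a path form a duplicate-free index type, which
   requires deciding equality of indices, hence [{classic I}]. *)
have /choice[lambda lamP] := fun j =>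
  @periodic_approximation R F K {classic I} s mu (Ej j) _ fs (j0 j).
have Ydet j : determined_by (Ej j) (agreeing_on psi E).
  move=> phi phi' e12 [i hi]; exists i => g Eg; rewrite -hi // e12 //.
  by rewrite mem_cat; apply/orP; left; move: Eg; rewrite EE.
exists lambda; split=> [j|].
  have [lam1 _ lam3] := lamP j; split => //.
  by apply: lam3 => //; apply: determined_byC.
apply: weak_cvg_determined => E' Y E'Y.
have /choice[idx idxP] := enumFP.
pose M := (\max_(g <- E') (idx g).+1)%N.
have YM j : (M <= j)%N -> determined_by (Ej j) Y.
  move=> Mj phi phi' e12; apply: E'Y => g gE'; apply: e12.
  rewrite mem_cat -(idxP g) map_f ?orbT // mem_iota add0n.
  by apply: leq_trans Mj; apply: (@leq_bigmax_seq _ E' xpredT (fun g => (idx g).+1)).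
apply/cvgrPdist_le => e e0.
near=> j; rewrite distrC.
have [_ lam2 _] := lamP j; apply: le_trans (lam2 Y _) _.
  by apply: YM; near: j; apply: nbhs_infty_ge.
by apply/ltW; near: j; apply: near_infty_natSinv_lt (PosNum e0).
Unshelve. all: by end_near.
Qed.

(** * Density of periodic measures *)

Theorem theorem3p4 (R : realType) (F : groupType) (K : pointedFinType)
    (fgF : finitely_generated F) (freeF : free_group F) :
  dense (@periodic_measure R F K) /\
  (forall (m : nat) (psi : 'I_m -> config F K) (E : set F)
      (mu : invariant_measure R F K),
    finite_set E ->
    supported_on mu (agreeing_on psi E) ->
    exists lambda : nat -> invariant_measure R F K,
      (forall j, periodic_measure (lambda j) /\
         supported_on (lambda j) (agreeing_on psi E)) /\
      lambda @ \oo --> mu).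
Proof.
split; last first.
  by move=> m psi E mu; apply: periodic_approximation_on_cylinders.
move=> O [mu Omu] oO.
(* With no constrained coordinate, every configuration is admissible. *)
pose psi (_ : 'I_1) : config F K := fun=> point.
have psiT : agreeing_on psi set0 = setT.
  by rewrite eqEsubset; split => // phi _; exists ord0.
have [||lambda [lamP lamcvg]] :=
  @periodic_approximation_on_cylinders R F K _ psi set0 mu fgF freeF.
- exact: finite_set0.
- by rewrite /supported_on psiT setCT measure0.
have Olam : \forall j \near \oo, O (lambda j).
  exact: lamcvg O (open_nbhs_nbhs (conj oO Omu)).
have [j Oj] := filter_ex Olam.
by exists (lambda j); split => //; case: (lamP j).
Qed.
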